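(* Let $d\ge3$ be odd, let $N_d$ be the number of isomorphism classes of extremal dessins of degree $d$ (those with passport $\langle(d),(d),(d)\rangle$), and let $M_d=\sum_{\mathcal{D}}1/|\mathrm{Aut}(\mathcal{D})|$, the sum over these classes. For every extremal dessin $\mathcal{D}$ of degree $d$, $|\mathrm{Aut}(\mathcal{D})|$ divides $d$, and $$\frac{2\,(d-1)!}{d(d+1)}=M_d\le N_d\le d\,M_d=\frac{2\,(d-1)!}{d+1}.$$
   Context: A dessin of degree $d$ is (equivalently) an isomorphism class of pairs $(X,t)$ with $X$ a smooth projective connected curve over $\mathbb{C}$ and $t\colon X\to\mathbb{P}^1$ a morphism of degree $d$ branched only over $\{0,1,\infty\}$; equivalently a triple $(\sigma_0,\sigma_1,\sigma_\infty)\in\mathfrak{S}_d^3$ with $\sigma_0\sigma_1\sigma_\infty=1$ and $\langle\sigma_0,\sigma_1\rangle$ transitive, up to simultaneous conjugation. The passport is the triple of cycle types; passport $\langle(d),(d),(d)\rangle$ means all three are $d$-cycles. $\mathrm{Aut}(\mathcal{D})$ is the automorphism group of the Belyi map, equal to the centralizer of $\langle\sigma_0,\sigma_1\rangle$ in $\mathfrak{S}_d$. *)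

(* Defs.v *)
From mathcomp Require Import all_boot all_order all_fingroup all_algebra.

Set Implicit Arguments.
Unset Strict Implicit.
Unset Printing Implicit Defensive.

Local Open Scope group_scope.

(* MathComp composes permutations from left to right, (s * t) x = t (s x).
   Inverting the three components exchanges the two composition conventions
   and preserves transitivity, conjugacy, cycle types and centralizers. *)
Definition triple (d : nat) : finType := ('S_d * 'S_d * 'S_d)%type.

Definition sigma0 d (t : triple d) : 'S_d := t.1.1.
Definition sigma1 d (t : triple d) : 'S_d := t.1.2.
Definition sigmaoo d (t : triple d) : 'S_d := t.2.

Definition monodromy d (t : triple d) : {group 'S_d} :=
  <<[set sigma0 t; sigma1 t]>>%G.

Definition dessin_triples (d : nat) : {set triple d} :=
  [set t : triple d | (sigma0 t * sigma1 t * sigmaoo t == 1)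
                      && [transitive monodromy t, on [set: 'I_d] | 'P]].

Definition conj_triple d (t : triple d) (g : 'S_d) : triple d :=
  (sigma0 t ^ g, sigma1 t ^ g, sigmaoo t ^ g).

Lemma conj_triple1 d : (@conj_triple d)^~ 1 =1 id.
Proof. by case=> [[a b] c]; rewrite /conj_triple /= !conjg1. Qed.

Lemma conj_tripleM d (t : triple d) (g h : 'S_d) :
  conj_triple t (g * h) = conj_triple (conj_triple t g) h.
Proof. by rewrite /conj_triple /= !conjgM. Qed.

Canonical conj_triple_action d :=
  TotalAction (@conj_triple1 d) (@conj_tripleM d).

(* A dessin is an orbit of simultaneous conjugation, so that the elements of
   [dessins d] are the isomorphism classes. *)
Definition dessins (d : nat) : {set {set triple d}} :=
  [set orbit (conj_triple_action d) [set: 'S_d] t | t in dessin_triples d].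

Definition cycle_type d (s : 'S_d) : seq nat :=
  sort geq [seq #|B| | B : {set 'I_d} in porbits s].

Definition triple_passport d (t : triple d) : seq nat * seq nat * seq nat :=
  (cycle_type (sigma0 t), cycle_type (sigma1 t), cycle_type (sigmaoo t)).

Definition triple_aut d (t : triple d) : {group 'S_d} := 'C(monodromy t)%G.

(* Invariants of a dessin are read on a representative; the choice is
   irrelevant by [passport_repr] and [card_dessin_aut_repr]. The default value is
   never used, since orbits are nonempty. *)
Definition dessin_repr d (D : {set triple d}) : triple d :=
  odflt (1, 1, 1) [pick t in D].

Definition passport d (D : {set triple d}) : seq nat * seq nat * seq nat :=
  triple_passport (dessin_repr D).

Definition dessin_aut d (D : {set triple d}) : {group 'S_d} :=
  triple_aut (dessin_repr D).

Definition extremal_dessins (d : nat) : {set {set triple d}} :=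
  [set D in dessins d | passport D == ([:: d], [:: d], [:: d])].

Definition extremal_count (d : nat) : nat := #|extremal_dessins d|.

Definition extremal_mass (d : nat) : rat :=
  (\sum_(D in extremal_dessins d) (#|dessin_aut D|%:R)^-1)%R.

Lemma porbitJ d (s g : 'S_d) (x : 'I_d) :
  porbit (s ^ g) (g x) = g @: porbit s x.
Proof.
apply/setP=> y; apply/porbitP/imsetP => [[i ->]|[z /porbitP[i ->] ->]].
  by exists ((s ^+ i) x); rewrite ?mem_porbit // -conjXg permJ.
by exists i; rewrite -conjXg permJ.
Qed.

Lemma cycle_typeJ d (s g : 'S_d) : cycle_type (s ^ g) = cycle_type s.
Proof.
have inj_g : injective (fun B : {set 'I_d} => g @: B).
  exact: imset_inj (@perm_inj _ g).
have porbitsJ : porbits (s ^ g) = [set g @: B | B : {set 'I_d} in porbits s].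
  apply/setP=> B; apply/imsetP/imsetP => [[x _ ->]|[_ /imsetP[x _ ->] ->]].
    exists (porbit s (g^-1 x)); first exact: imset_f.
    by rewrite -porbitJ permKV.
  by exists (g x); rewrite ?porbitJ.
apply/perm_sortP.
- by move=> m n; apply: leq_total.
- by move=> m n p le_mn le_pm; apply: leq_trans le_pm le_mn.
- by move=> m n le_mn; apply/eqP; rewrite eqn_leq andbC.
have enumJ : perm_eq (enum (porbits (s ^ g)))
                     [seq g @: B | B : {set 'I_d} in porbits s].
  apply: uniq_perm; rewrite ?enum_uniq ?map_inj_uniq ?enum_uniq // => B.
  by rewrite mem_enum porbitsJ; apply/imsetP/imageP.
rewrite /image_mem; apply: perm_trans (perm_map _ enumJ) _.
rewrite -map_comp (eq_map (g := fun B : {set 'I_d} => #|B|)) // => B /=.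
by rewrite card_imset //; apply: perm_inj.
Qed.

Lemma dessin_repr_conj d (D : {set triple d}) (t : triple d) :
  D \in dessins d -> t \in D -> exists g, dessin_repr D = conj_triple t g.
Proof.
case/imsetP=> u _ -> Dt; rewrite /dessin_repr; case: pickP => [v|/(_ t)].
  by rewrite -(orbit_eqP Dt) => /orbitP[g _ <-]; exists g.
by rewrite Dt.
Qed.

Lemma passport_repr d (D : {set triple d}) (t : triple d) :
  D \in dessins d -> t \in D -> passport D = triple_passport t.
Proof.
move=> dD Dt; have [g] := dessin_repr_conj dD Dt.
by rewrite /passport => ->; rewrite /triple_passport !cycle_typeJ.
Qed.

Lemma card_dessin_aut_repr d (D : {set triple d}) (t : triple d) :
  D \in dessins d -> t \in D -> #|dessin_aut D| = #|triple_aut t|.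
Proof.
move=> dD Dt; have [g] := dessin_repr_conj dD Dt.
rewrite /dessin_aut => -> /=; rewrite !cent_gen.
rewrite -[RHS](cardJg _ g) -centJ.
by rewrite conjUg !conjg_set1.
Qed.

(* Main.v *)
(** Fix a full cycle [c] on a set of [n] points and count the full cycles [a]
    such that [c^-1 o a] is again a full cycle. For a permutation [r] and a
    point [x], the sum of [(-1)^(number of cycles of r in U)] over the
    [r]-invariant sets [U] avoiding [x] is [1] if [r] is a full cycle and [0]
    otherwise; the summand is also [(-1)^#|U|] times the signature of [r] on
    [U]. Take [r = c^-1 o a], sum over [x] and exchange the sums over [a] and
    [U]: the invariance of [U] becomes [a(U) = c(U)]. If two points [i], [j] lie
    in [U] but not in [c(U)], conjugating [a] by the transposition [(i j)]
    reverses the sign, so only the empty set and the arcs of [c] contribute. For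
    an arc with [k] points the admissible [a] are [(k-1)! (n-k-1)!] conjugates
    of [c], all counted with the sign [(-1)^k]. The resulting sum
    [(n-1)! + sum_(1 <= k < n) (-1)^k (k-1)! (n-k)!] telescopes after
    multiplication by [n+1] and equals [2 (n-1)! / (n+1)] for odd [n]. The mass
    is the number of extremal triples divided by [d!], by the orbit-stabilizer
    theorem. *)
Require Import Defs.
From mathcomp Require Import all_boot all_order all_fingroup all_algebra.
From mathcomp Require Import cyclic ring.

Set Implicit Arguments.
Unset Strict Implicit.
Unset Printing Implicit Defensive.

Import GRing.Theory Num.Theory.
Local Open Scope group_scope.

Definition full_cycle (T : finType) (s : {perm T}) : bool :=
  #|porbits s| == 1%N.

(** * Full cycles *)

Section FullCycle.

Variable T : finType.
Implicit Types (a c g s : {perm T}) (x y u : T) (U V : {set T}).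

Lemma full_cycle_porbit s x : full_cycle s -> porbit s x = setT.
Proof.
case/cards1P=> B porbitsE; apply/setP=> y; rewrite inE -eq_porbit_mem.
have mem z : porbit s z = B by apply/set1P; rewrite -porbitsE imset_f.
by rewrite !mem eqxx.
Qed.

Lemma porbit_full_cycle s x : porbit s x = setT -> full_cycle s.
Proof.
move=> sx; apply/cards1P; exists setT; apply/setP=> B; rewrite inE.
apply/imsetP/eqP => [[y _ ->]|->]; last by exists x.
by rewrite -sx; apply/eqP; rewrite eq_porbit_mem sx inE.
Qed.

Lemma full_cycle_inhab s : full_cycle s -> exists u : T, u \in T.
Proof.
case/cards1P=> B /setP/(_ B); rewrite set11 => /imsetP[u _ _].
by exists u.
Qed.

Lemma full_cycleX s x y : full_cycle s -> exists i, y = (s ^+ i) x.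
Proof. by move=> fs; apply/porbitP; rewrite full_cycle_porbit ?inE. Qed.

Lemma full_cycleJ s g : full_cycle (s ^ g) = full_cycle s.
Proof.
suff fJ (r h : {perm T}) : full_cycle r -> full_cycle (r ^ h).
  by apply/idP/idP=> /fJ; [move/(_ g^-1); rewrite conjgK | apply].
move=> fr; have [x _] := full_cycle_inhab fr.
apply: (@porbit_full_cycle _ (h x)); apply/setP=> y; rewrite inE.
have [i def_y] := full_cycleX x (h^-1 y) fr.
by apply/porbitP; exists i; rewrite -conjXg permJ -def_y permKV.
Qed.

Lemma expg_perm_comm s g i : commute s g -> forall x, g ((s ^+ i) x) = (s ^+ i) (g x).
Proof. by move=> csg x; rewrite -!permM (commuteX i (commute_sym csg)). Qed.

Lemma full_cycle_cent_fix c g u :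
  full_cycle c -> commute c g -> g u = u -> g = 1.
Proof.
move=> fc ccg gu; apply/permP=> y; have [i ->] := full_cycleX u y fc.
by rewrite (expg_perm_comm i ccg) gu perm1.
Qed.

(** Some power of [c] agrees with [g] at one point, and commuting with a full cycle propagates the
    agreement to all points. *)
Lemma full_cycle_cent c : full_cycle c -> 'C[c] \subset <[c]>.
Proof.
move=> fc; apply/subsetP=> g /cent1P/commute_sym ccg.
have [u _] := full_cycle_inhab fc.
have [i gu] := full_cycleX u (g u) fc.
suff /(congr1 (mulg^~ (c ^+ i))): g * c ^- i = 1.
  by rewrite mulgKV mul1g => ->; apply: mem_cycle.
apply: (full_cycle_cent_fix (u := u) fc); last by rewrite permM gu permK.
by apply: commuteM => //; apply/commuteV/commuteX.
Qed.

Lemma full_cycle_expg_eq c u i j :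
  full_cycle c -> (c ^+ i) u = (c ^+ j) u -> c ^+ i = c ^+ j.
Proof.
move=> fc cij; apply/permP=> x; have [k ->] := full_cycleX u x fc.
by rewrite -!permM -!expgD addnC [(k + j)%N]addnC !expgD !permM cij.
Qed.

Lemma full_cycle_order c : full_cycle c -> #[c] = #|T|.
Proof.
move=> fc; have [u _] := full_cycle_inhab fc.
rewrite -cardsT -(full_cycle_porbit u fc) porbit.unlock card_in_imset //.
by move=> _ _ /cycleP[i ->] /cycleP[j ->] /(full_cycle_expg_eq fc).
Qed.

Lemma full_cycle_expg_inj c u i j : full_cycle c -> i < #|T| -> j < #|T| ->
  (c ^+ i) u = (c ^+ j) u -> i = j.
Proof.
move=> fc lt_i lt_j /(full_cycle_expg_eq fc)/eqP.
by rewrite eq_expg_mod_order full_cycle_order // !modn_small // => /eqP.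
Qed.

Lemma full_cycle_idx c u y : full_cycle c -> exists2 i, i < #|T| & y = (c ^+ i) u.
Proof.
move=> fc; have /porbitPmin[i] : y \in porbit c u.
  by rewrite full_cycle_porbit ?inE.
by rewrite full_cycle_order //; exists i.
Qed.

(** The conjugator sends [(c ^+ i) u] to [(a ^+ i) u]; this is consistent because both cycles have
    order [#|T|]. *)
Lemma full_cycle_conj c a u :
  full_cycle c -> full_cycle a -> exists2 g : {perm T}, g u = u & c ^ g = a.
Proof.
move=> fc fa; have ex_idx y : exists i, y == (c ^+ i) u.
  by have [i ->] := full_cycleX u y fc; exists i.
pose idx y := xchoose (ex_idx y).
have idxE y : y = (c ^+ idx y) u by apply/eqP/(xchooseP (ex_idx y)).
have trans (s r : {perm T}) i j : full_cycle s -> full_cycle r ->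
    (s ^+ i) u = (s ^+ j) u -> (r ^+ i) u = (r ^+ j) u.
  move=> fs fr /(full_cycle_expg_eq fs)/eqP; rewrite eq_expg_mod_order.
  rewrite full_cycle_order // -(full_cycle_order fr) -eq_expg_mod_order.
  by move/eqP->.
have inj_f : injective (fun y => (a ^+ idx y) u).
  by move=> y z /(trans _ _ _ _ fa fc); rewrite -!idxE.
have gE i : perm inj_f ((c ^+ i) u) = (a ^+ i) u.
  by rewrite permE; apply: (trans c a) => //; rewrite -idxE.
exists (perm inj_f); first by have := gE 0; rewrite !expg0 !perm1.
apply/permP=> y; rewrite -(permKV (perm inj_f) y) permJ.
have [i ->] := full_cycleX u ((perm inj_f)^-1 y) fc.
by rewrite gE -[c _]permM -expgSr gE expgSr permM.
Qed.

(** Only the identity commutes with [c] and fixes [u], so conjugation of [c] is a bijection from the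
    stabilizer of [u] onto the full cycles. *)
Lemma full_cycle_sum (R : nmodType) (F : {perm T} -> R) c u : full_cycle c ->
  (\sum_(a | full_cycle a) F a = \sum_(g : {perm T} | g u == u) F (c ^ g)%g)%R.
Proof.
move=> fc; symmetry.
rewrite (eq_bigl (mem [set g : {perm T} | g u == u])); last first.
  by move=> g; rewrite /= inE.
rewrite -(big_imset (h := fun g => c ^ g)) /=; last first.
  move=> g h; rewrite !inE => /eqP gu /eqP hu cgh.
  suff /(congr1 (mulg^~ h)): g * h^-1 = 1 by rewrite mulgKV mul1g.
  apply: (full_cycle_cent_fix (u := u) fc); last by rewrite permM gu -{1}hu permK.
  by apply/commgP; rewrite commgEl conjgM cgh conjgK mulVg.
apply: eq_bigl => a; apply/imsetP/idP => [[g _ ->]|fa]; first by rewrite full_cycleJ.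
by have [g gu <-] := full_cycle_conj u fc fa; exists g; rewrite ?inE ?gu.
Qed.

Lemma card_full_cycles c :
  full_cycle c -> #|[set a : {perm T} | full_cycle a]| = (#|T|.-1)`!.
Proof.
move=> fc; have [u _] := full_cycle_inhab fc.
rewrite -sum1_card (eq_bigl _ _ (in_set _)) (full_cycle_sum (fun=> 1%N) u fc).
rewrite -cardsT (cardsD1 u) inE /= -card_Sym sum1_card; apply: eq_card => g.
rewrite !inE; apply/eqP/subsetP => [gu x|/(_ u)].
  by rewrite !inE andbT; apply: contra => /eqP->; rewrite gu.
by move=> fix_u; apply/eqP; apply: contraT => /fix_u; rewrite !inE eqxx.
Qed.

End FullCycle.

(** * Signs of invariant sets *)

Section InvariantSets.

Variable T : finType.
Implicit Types (s : {perm T}) (x : T) (U : {set T}).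

Definition orbits_in U s : {set {set T}} := [set O in porbits s | O \subset U].

(** The signature is used because [restr_perm U] is a morphism on the stabilizer of [U], which makes
    signs of products computable; [inv_signE] recovers the cycle count. *)
Definition inv_sign U s : int := ((-1) ^+ (#|U| + odd_perm (restr_perm U s)))%R.

Lemma astabs_permX U s i x :
  s \in 'N(U | 'P) -> ((s ^+ i) x \in U) = (x \in U).
Proof. by move=> /(groupX i)/astabsP/(_ x). Qed.

Lemma porbit_sub_inv U s x : s \in 'N(U | 'P) -> (porbit s x \subset U) = (x \in U).
Proof.
move=> sU; apply/subsetP/idP=> [-> //|Ux y]; first exact: porbit_id.
by case/porbitP=> i ->; rewrite astabs_permX.
Qed.

(** [odd_perm] counts cycles on all of [T], so the points outside [U], now fixed, must be listed
    too. *)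
Lemma porbits_restr_perm U s : s \in 'N(U | 'P) ->
  porbits (restr_perm U s) = orbits_in U s :|: [set [set x] | x in ~: U].
Proof.
move=> sU; have inU x : x \in U -> porbit (restr_perm U s) x = porbit s x.
  move=> Ux; apply/setP=> y; apply/porbitP/porbitP=> -[i ->]; exists i.
    by rewrite -morphX // restr_permE ?groupX.
  by rewrite -morphX // restr_permE ?groupX.
have outU x : x \notin U -> porbit (restr_perm U s) x = [set x].
  move=> Ux; apply/setP=> y; rewrite inE; apply/porbitP/eqP=> [[i ->]|->].
    by rewrite -morphX // (out_perm (restr_perm_on _ _)).
  by exists 0; rewrite expg0 perm1.
apply/setP=> O; rewrite !inE; apply/imsetP/orP=> [[x _ ->]|[/andP[]|]].
- have [Ux|Ux] := boolP (x \in U); [left | right].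
    by rewrite inU // imset_f //= porbit_sub_inv.
  by rewrite outU // imset_f // inE.
- by case/imsetP=> x _ ->; rewrite porbit_sub_inv // => /inU <-; exists x.
- by case/imsetP=> x; rewrite inE => /outU <- ->; exists x.
Qed.

Lemma inv_signE U s : s \in 'N(U | 'P) -> inv_sign U s = ((-1) ^+ #|orbits_in U s|)%R.
Proof.
move=> sU; rewrite /inv_sign /odd_perm porbits_restr_perm // cardsU.
have -> : orbits_in U s :&: [set [set x] | x in ~: U] = set0.
  apply/setP=> O; rewrite !inE; apply/negP=> /andP[/andP[_ sOU]].
  by case/imsetP=> x; rewrite inE => /negP Ux defO; case: Ux; rewrite -sub1set -defO.
rewrite cards0 subn0 card_imset; last exact: set1_inj.
rewrite -signr_odd -(cardsC U) -[RHS]signr_odd oddD oddb !oddD.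
by case: (odd _) (odd _) (odd _) => [] [] [].
Qed.

(** For a full cycle only the empty set contributes. Otherwise some cycle [O] misses [x], and adding
    or removing [O] is a sign-reversing involution on the sets [U]. *)
Lemma sum_inv_sign s x :
  (\sum_(U : {set T} | (s \in 'N(U | 'P)) && (x \notin U)) inv_sign U s
     = (full_cycle s)%:R)%R.
Proof.
have -> : (\sum_(U : {set T} | (s \in 'N(U | 'P)) && (x \notin U)) inv_sign U s =
    \sum_(U : {set T} | (s \in 'N(U | 'P)) && (x \notin U)) (-1) ^+ #|orbits_in U s|)%R.
  by apply: eq_bigr => U /andP[/inv_signE].
have [fs|nfs] := boolP (full_cycle s).
  rewrite (big_pred1 set0) => [|U].
    rewrite (_ : orbits_in _ _ = set0) ?cards0 //; apply/setP=> O; rewrite !inE.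
    apply/negP=> /andP[/imsetP[y _ ->]]; rewrite subset0 => /eqP/setP/(_ y).
    by rewrite porbit_id inE.
  apply/andP/eqP=> [[sU]|->]; last first.
    by rewrite in_set0; split=> //; apply/astabsP=> y; rewrite !in_set0.
  apply: contraNeq => /set0Pn[y Uy]; have [i ->] := full_cycleX y x fs.
  by rewrite astabs_permX.
have [y xy] : exists y, y \notin porbit s x.
  apply/existsP; apply: contraR nfs; rewrite negb_exists => /forallP sx.
  apply: (@porbit_full_cycle _ _ x); apply/setP=> y; rewrite inE.
  by have := sx y; rewrite negbK => ->.
set O := porbit s y; pose h U : {set T} := [set z | (z \in U) (+) (z \in O)].
have h_inv : involutive h.
  by move=> U; apply/setP=> z; rewrite !inE addbK.
have sO : s \in 'N(O | 'P).
  by apply/astabsP=> z; rewrite /= -!eq_porbit_mem (porbit_perm s 1).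
have sh U : s \in 'N(U | 'P) -> s \in 'N(h U | 'P).
  move=> sU; apply/astabsP=> z; rewrite !inE.
  by rewrite (astabsP sU) (astabsP sO).
set S := (RHS in _ = RHS); set S' := (LHS in LHS = _).
suff /eqP : (S' = - S')%R by rewrite -addr_eq0 -mulr2n mulrn_eq0 => /eqP.
rewrite {1}/S' (reindex_inj (inv_inj h_inv)) -sumrN.
apply: eq_big => [U|U /andP[sU _]]; last first.
  have {}sU : s \in 'N(U | 'P) by rewrite -(h_inv U) sh.
  have orbits_h P : (P \in orbits_in (h U) s) = (P \in orbits_in U s) (+) (P == O).
    rewrite !inE; have [/imsetP[z _ ->]|nP] /= := boolP (P \in porbits s).
      by rewrite !porbit_sub_inv ?sh // !inE eq_porbit_mem.
    by apply/esym; apply: contraNF nP => /eqP->; apply: imset_f.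
  have [OU|OU] := boolP (O \in orbits_in U s).
    have -> : orbits_in (h U) s = orbits_in U s :\ O.
      apply/setP=> P; rewrite orbits_h in_setD1.
      by have [->|] := eqVneq P O; rewrite ?OU ?addbF.
    by rewrite [in RHS](cardsD1 O) OU exprS mulN1r opprK.
  have -> : orbits_in (h U) s = O |: orbits_in U s.
    apply/setP=> P; rewrite orbits_h in_setU1.
    by have [->|] := eqVneq P O; rewrite ?(negPf OU) ?addbF.
  by rewrite cardsU1 OU exprS mulN1r.
congr (_ && _); last by rewrite inE [x \in O]porbit_sym (negPf xy) addbF.
by apply/idP/idP=> /sh; rewrite ?h_inv.
Qed.

(** Summing [sum_inv_sign] over [x] counts each [U] once for every point outside it. *)
Lemma sum_inv_sign_card s :
  (\sum_(U : {set T} | s \in 'N(U | 'P)) #|~: U|%:R * inv_sign U s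
     = #|T|%:R * (full_cycle s)%:R :> int)%R.
Proof.
transitivity (\sum_(x : T) (full_cycle s)%:R : int)%R; last first.
  by rewrite sumr_const mulr_natl -cardsT cardsE.
under [RHS]eq_bigr => x _ do rewrite -(sum_inv_sign s x).
rewrite (exchange_big_dep (fun U => s \in 'N(U | 'P))) /=; last by move=> ? U _ /andP[].
apply: eq_bigr => U sU; rewrite -sum1_card natr_sum mulr_suml.
by apply: eq_big => [x|x _]; rewrite ?mul1r // inE sU.
Qed.

End InvariantSets.

(** * Arcs of a full cycle *)

Section StabilizersOfSets.

Variable T : finType.
Implicit Types (g s : {perm T}) (x u v : T) (A U : {set T}).

Lemma perm_on_astabs A U s : A \subset U -> perm_on A s -> s \in 'N(U | 'P).
Proof.
move=> /subsetP sAU sA; apply/astabsP=> x; rewrite /= /aperm.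
have [Ax|nAx] := boolP (x \in A); last by rewrite (out_perm sA).
by rewrite !sAU // perm_closed.
Qed.

Lemma restr_perm_id U s : perm_on U s -> restr_perm U s = s.
Proof.
move=> sU; have sNU := perm_on_astabs (subxx U) sU.
apply/permP=> x; have [Ux|nUx] := boolP (x \in U); first exact: restr_permE.
by rewrite !(out_perm (S := U)) // restr_perm_on.
Qed.

Lemma restr_perm_triv A U s : [disjoint A & U] -> perm_on A s -> restr_perm U s = 1.
Proof.
move=> dAU sA; have sNU : s \in 'N(U | 'P).
  by rewrite -astabsC (perm_on_astabs (A := A)) // subsets_disjoint setCK.
apply/permP=> x; rewrite perm1; have [Ux|nUx] := boolP (x \in U).
  by rewrite restr_permE // (out_perm sA) // (disjointFl dAU).
by rewrite (out_perm (restr_perm_on _ _)).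
Qed.

(** These permutations form the direct product of the symmetric groups on [U :\ u] and
    [~: U :\ v]. *)
Lemma card_astabs_fix2 U u v : u \in U -> v \notin U ->
  #|[set g in 'N(U | 'P) | (g u == u) && (g v == v)]|
    = (#|U|.-1`! * #|~: U|.-1`!)%N.
Proof.
move=> Uu nUv; set A := U :\ u; set B := ~: U :\ v.
have -> : #|U|.-1 = #|A| by rewrite (cardsD1 u) Uu.
have -> : #|~: U|.-1 = #|B| by rewrite (cardsD1 v) inE nUv.
have AB x : x \in A -> x \notin B by rewrite !inE => /andP[_ ->]; rewrite andbF.
rewrite -!card_Sym -TI_cardMg; last first.
  apply/trivgP/subsetP=> g; rewrite !inE => /andP[gA gB]; apply/eqP/permP=> x.
  rewrite perm1; have [Ax|] := boolP (x \in A); last exact: out_perm.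
  by rewrite (out_perm gB) ?AB.
apply: eq_card => g; apply/idP/mulsgP => [|[h1 h2]].
  rewrite inE => /and3P[gU /eqP gu /eqP gv].
  have gA : g \in 'N(A | 'P).
    apply/astabsP=> x; rewrite !inE -{1}gu (inj_eq perm_inj).
    by congr (_ && _); apply: (astabsP gU).
  have gB : g \in 'N(B | 'P).
    apply/astabsP=> x; rewrite !inE -{1}gv (inj_eq perm_inj).
    by congr (_ && ~~ _); apply: (astabsP gU).
  exists (restr_perm A g) (restr_perm B g); rewrite ?inE ?restr_perm_on //.
  apply/permP=> x; rewrite permM; have [Ax|nAx] := boolP (x \in A).
    rewrite (restr_permE gA Ax) (out_perm (restr_perm_on B _)) // AB //.
    by have /= -> := astabsP gA x.
  rewrite (out_perm (restr_perm_on A _)) //; have [Bx|nBx] := boolP (x \in B).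
    by rewrite restr_permE.
  rewrite (out_perm (restr_perm_on B _)) //.
  have [->//|xu] := eqVneq x u; have [->//|xv] := eqVneq x v.
  by move: nAx nBx; rewrite !inE xu xv /= => /negPf->.
rewrite [h1 \in _]inE [h2 \in _]inE => h1A h2B ->; rewrite in_set.
have [uA uB vA vB] : [/\ u \notin A, u \notin B, v \notin A & v \notin B].
  by rewrite !inE !eqxx Uu (negPf nUv) !andbF.
rewrite !permM (out_perm h1A uA) (out_perm h2B uB) (out_perm h1A vA).
rewrite (out_perm h2B vB) !eqxx !andbT.
have h1N : h1 \in 'N(U | 'P) by apply: perm_on_astabs h1A; apply: subsetDl.
have h2N : h2 \in 'N(U | 'P).
  by rewrite -astabsC; apply: perm_on_astabs h2B; apply: subsetDl.
by rewrite groupM.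
Qed.

End StabilizersOfSets.

(** * Arcs of [c] and signed counts of full cycles *)

Section ArcsOfFullCycle.

Variables (T : finType) (c : {perm T}).
Hypothesis fc : full_cycle c.
Implicit Types (a g : {perm T}) (x y u v : T) (U V : {set T}).

Definition arc_from u k : {set T} := [set (c ^+ i) u | i : 'I_k].

Lemma mem_imset_perm V x : (x \in c @: V) = (c^-1 x \in V).
Proof. by rewrite -{1}(permKV c x) mem_imset //; apply: perm_inj. Qed.

Lemma full_cycle_expg_neq u i : 0 < i < #|T| -> (c ^+ i) u != u.
Proof.
case/andP=> i_gt0 lt_iT; apply/eqP=> cu; move: i_gt0.
rewrite (full_cycle_expg_inj fc (i := i) (j := 0) (u := u)) ?perm1 //.
exact: leq_ltn_trans lt_iT.
Qed.

(** Going back along [c] can leave [V] only from a point of [V :\: c @: V], hence only from [u]; the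
    bound [j < #|T|] keeps the walk from meeting [u] before exponent 0. *)
Lemma arc_downward V u i j : V :\: c @: V \subset [set u] ->
  i <= j -> j < #|T| -> (c ^+ j) u \in V -> (c ^+ i) u \in V.
Proof.
move=> Vu; elim: j => [|j IHj]; first by rewrite leqn0 => /eqP->.
rewrite leq_eqVlt => /predU1P[-> //|le_ij] lt_jT Vj.
apply: IHj => //; first exact: ltnW.
have := subsetP Vu ((c ^+ j.+1) u).
rewrite in_setD Vj andbT mem_imset_perm in_set1 (negPf (full_cycle_expg_neq _ _)) //.
by rewrite {1}expgSr permM permK; case: (_ \in V) => // /(_ isT).
Qed.

(** Both sets are initial segments of the sequence [u], [c u], [(c ^+ 2) u], ..., so one contains
    the other. *)
Lemma arc_uniq U V u : U :\: c @: U \subset [set u] ->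
  V :\: c @: V \subset [set u] -> #|U| = #|V| -> U = V.
Proof.
move=> Uu Vu eqUV; apply/eqP; have [sUV|] := boolP (U \subset V).
  by rewrite eqEcard sUV eqUV leqnn.
have [sVU|] := boolP (V \subset U); first by rewrite eq_sym eqEcard sVU eqUV leqnn.
case/subsetPn=> x Vx Ux /subsetPn[y Uy Vy].
have [i lti defx] := full_cycle_idx u x fc.
have [j ltj defy] := full_cycle_idx u y fc.
have [le_ij|/ltnW le_ji] := leqP i j.
  by case/negP: Ux; rewrite defx (arc_downward Uu le_ij) -?defy.
by case/negP: Vy; rewrite defy (arc_downward Vu le_ji) -?defx.
Qed.

Lemma card_arc_from u k : k <= #|T| -> #|arc_from u k| = k.
Proof.
move=> le_kT; rewrite card_imset ?card_ord // => i j.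
by move/(full_cycle_expg_inj fc) => eq_ij; apply/val_inj/eq_ij; apply: leq_trans le_kT.
Qed.

Lemma arc_from_diff u k : 0 < k < #|T| -> 
  arc_from u k :\: c @: arc_from u k = [set u].
Proof.
case/andP=> k_gt0 lt_kT; apply/setP=> x; rewrite !inE mem_imset_perm.
apply/andP/eqP=> [[cx /imsetP[[[|i] lt_ik] _ defx]]|->].
- by rewrite defx perm1.
- case/negP: cx; apply/imsetP; exists (Ordinal (ltnW lt_ik)) => //=.
  by rewrite defx /= expgSr permM permK.
split; last by apply/imsetP; exists (Ordinal k_gt0); rewrite ?perm1.
apply/imsetP=> -[i _ /(canRL (permKV c))/esym/eqP]; rewrite -permM -expgSr.
by apply/negP/full_cycle_expg_neq/(leq_ltn_trans (ltn_ord i)).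
Qed.

(** By [arc_uniq] the sets with first point [u] are the [arc_from u k], one for each size. Sizes 0
    and [#|T|] are excluded because the empty set and the whole set have no first point. *)
Lemma sum_arcs (R : nmodType) (F : nat -> R) u :
  (\sum_(U : {set T} | U :\: c @: U == [set u]) F #|U| = \sum_(1 <= k < #|T|) F k)%R.
Proof.
symmetry; pose A := [set k : 'I_#|T| | 0 < k].
transitivity (\sum_(k in A) F k)%R.
  rewrite big_geq_mkord /=; apply: eq_bigl => k; by rewrite inE.
rewrite (eq_bigr (fun k : 'I_#|T| => F #|arc_from u k|)) => [|k _]; last first.
  by rewrite card_arc_from // ltnW.
rewrite -(big_imset (h := fun k : 'I_#|T| => arc_from u k)
  (fun U : {set T} => F #|U|)) /=.
  apply: eq_bigl => U; apply/imsetP/eqP=> [[k]|Uu].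
    by rewrite inE => k_gt0 ->; rewrite arc_from_diff ?k_gt0 /=.
  have Uu' : u \in U :\: c @: U by rewrite Uu set11.
  have U_gt0 : 0 < #|U| by rewrite (cardD1 u); case/setDP: Uu' => ->.
  have ltUT : #|U| < #|T|.
    rewrite -(card_imset U (@perm_inj _ c)) -cardsT proper_card // properT.
    by apply/eqP=> cUT; move: Uu'; rewrite cUT !inE.
  exists (Ordinal ltUT); first by rewrite inE.
  apply: (arc_uniq (u := u)); first by rewrite Uu.
    by rewrite arc_from_diff ?U_gt0 /=.
  by rewrite card_arc_from // ltnW.
move=> i j _ _ /(congr1 (fun U : {set T} => #|U|)).
by rewrite !card_arc_from 1?ltnW // => /val_inj.
Qed.

(** Products compose from left to right, so [a * c^-1] applies [a] first; that it stabilizes [U]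
    means [a @: U = c @: U]. *)
Definition signed_count U : int :=
  (\sum_(a | full_cycle a && ((a * c^-1)%g \in 'N(U | 'P))) inv_sign U (a * c^-1)%g)%R.

Lemma signed_count0 : signed_count set0 = ((#|T|.-1)`!%:R)%R.
Proof.
rewrite -(card_full_cycles fc) -sum1_card natr_sum; apply: eq_big => [a|a _].
  rewrite inE andb_idr // => _; apply/astabsP=> x; by rewrite !in_set0.
have := restr_perm_on set0 (a * c^-1) => /perm_on_id; rewrite cards0 => /(_ isT) r1.
by rewrite /inv_sign cards0 r1 odd_perm1.
Qed.

(* Conjugating [a] by the transposition of two points of [U] outside [c @: U]
   keeps [a @: U = c @: U] and reverses the sign. *)
Lemma signed_count_eq0 U i j : i != j -> i \in U :\: c @: U -> j \in U :\: c @: U ->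
  signed_count U = 0%R.
Proof.
move=> neq_ij /setDP[Ui]; rewrite mem_imset_perm => ci /setDP[Uj].
rewrite mem_imset_perm => cj.
(* [t'] is the conjugate of [t] by [c^-1] and moves only points outside [U]. Hence in
   [t * (a * c^-1) * t'] only the factor [t] changes the sign on [U]. *)
pose t := tperm i j; pose t' := tperm (c^-1 i) (c^-1 j).
have t_on : perm_on U t.
  by apply: subset_trans (tperm_on i j) _; apply/subsetP=> x /set2P[]->.
have t'_on : perm_on (~: U) t'.
  by apply: subset_trans (tperm_on _ _) _; apply/subsetP=> x /set2P[]->; rewrite inE.
have tN := perm_on_astabs (subxx U) t_on.
have t'N : t' \in 'N(U | 'P) by rewrite -astabsC (perm_on_astabs (subxx _)).
have r_t' : restr_perm U t' = 1.
  by apply: restr_perm_triv t'_on; rewrite -setI_eq0 setIC setICr.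
have conj_t a : (a ^ t * c^-1 = t * (a * c^-1) * t')%g.
  by rewrite /t' -tpermJ conjgE tpermV conjgE invgK !mulgA !mulgKV.
have inv_t a : ((a ^ t * c^-1)%g \in 'N(U | 'P)) = ((a * c^-1)%g \in 'N(U | 'P)).
  by rewrite conj_t groupMr // groupMl.
suff /eqP : signed_count U = (- signed_count U)%R.
  by rewrite -addr_eq0 -mulr2n mulrn_eq0 => /eqP.
rewrite {1}/signed_count (reindex_inj (conjg_inj t)) -sumrN.
apply: eq_big => [a|a /andP[_]]; first by rewrite full_cycleJ inv_t.
rewrite inv_t /inv_sign conj_t; move: (a * c^-1) => b bN.
have -> : restr_perm U (t * b * t') = t * restr_perm U b.
  by rewrite !morphM ?groupM //= r_t' mulg1 restr_perm_id.
rewrite odd_permM odd_tperm neq_ij !exprD -mulrN; congr (_ * _)%R.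
by case: (odd_perm _).
Qed.

(* The full cycles [a] with [a @: U = c @: U] are the conjugates of [c] by the
   permutations fixing both end points of the arc and stabilizing it. The sign
   is positive because [a * c^-1] is a commutator in the stabilizer of [U]. *)
Lemma signed_count_arc U u : U :\: c @: U = [set u] ->
  signed_count U = ((-1) ^+ #|U| * (#|U|.-1`! * #|~: U|.-1`!)%:R)%R.
Proof.
move=> Uu; have card_cU : #|c @: U| = #|U| by apply/card_imset/perm_inj.
(* [c @: U] has the size of [U] and loses only [u], so it gains exactly one point [v], the one just
   after the arc. *)
have [v cUv] : exists v, c @: U :\: U = [set v].
  apply/cards1P; have := cardsID (c @: U) U; have := cardsID U (c @: U).
  rewrite card_cU Uu cards1 setIC => <- /eqP; rewrite eqn_add2l eq_sym.
  exact.
have /setDP[Uu' cUu] : u \in U :\: c @: U by rewrite Uu set11.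
have /setDP[cUv' nUv] : v \in c @: U :\: U by rewrite cUv set11.
have cUE x : (x \in c @: U) = (if x == u then false else if x == v then true else x \in U).
  have [->|xu] := eqVneq x u; first exact: negPf.
  have [->//|xv] := eqVneq x v.
  have /setP/(_ x) := Uu; have /setP/(_ x) := cUv; rewrite !in_setD !in_set1.
  by rewrite (negPf xu) (negPf xv); case: (x \in U); case: (x \in c @: U).
have invP g : g u = u ->
    reflect (forall y, (g (c y) \in c @: U) = (g y \in U)) ((c ^ g * c^-1)%g \in 'N(U | 'P)).
  move=> gu; apply: (iffP astabsP) => gU y.
    by have := gU (g y); rewrite /= /aperm permM permJ mem_imset_perm.
  by rewrite /= /aperm permM -{1}(permKV g y) permJ -mem_imset_perm gU permKV.
have gP g : ((g u == u) && ((c ^ g * c^-1)%g \in 'N(U | 'P)))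
          = (g \in [set g in 'N(U | 'P) | (g u == u) && (g v == v)]).
  rewrite [RHS]in_set; have [gu|_] := eqVneq (g u) u; last by rewrite !andFb andbF.
  rewrite !andTb.
  apply/(invP g gu)/andP=> [gU|[gN /eqP gv] y]; last first.
    have gNx x : (g x \in U) = (x \in U) by apply: (astabsP gN).
    rewrite cUE -{1}gu -{1}gv !(inj_eq perm_inj) !gNx -cUE.
    by rewrite mem_imset //; apply: perm_inj.
  (* The preimage of [U] under [g] has the size of [U], and [u] is its only possible first point, so
     [arc_uniq] identifies the two. *)
  have gUV : U = g @^-1: U.
    apply: (arc_uniq (u := u)); first by rewrite Uu.
      apply/subsetP=> y; rewrite in_setD mem_imset_perm !inE => /andP[gcy gy].
      rewrite -(inj_eq (@perm_inj _ g)) gu.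
      have := gU (c^-1 y); rewrite permKV (negPf gcy) cUE gy.
      by case: (g y == u) => //; case: ifP.
    by rewrite -[LHS](card_preimset _ (@perm_inj _ g)).
  have gN : g \in 'N(U | 'P).
    by apply/astabsP=> x; rewrite /= /aperm {2}gUV inE.
  split=> //; have gcv : g v \in c @: U.
    have := gU (c^-1 v); rewrite permKV => ->.
    by have /= -> := astabsP gN (c^-1 v); rewrite -mem_imset_perm.
  have : g v \in c @: U :\: U.
    by rewrite inE gcv andbT; have /= -> := astabsP gN v.
  by rewrite cUv inE.
rewrite /signed_count big_mkcondr (full_cycle_sum _ u fc) -big_mkcondr.
rewrite (eq_bigl _ _ gP) (eq_bigr (fun=> ((-1) ^+ #|U|)%R)); last first.
  move=> g; rewrite inE => /and3P[gN /eqP gu /eqP gv].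
  (* [c] replaces [u] by [v] in [U]; swapping them back gives a [q] that stabilizes [U]. As [g]
     commutes with the swap, [c] may be replaced by [q] in the quotient. *)
  pose q := c * tperm u v.
  have gq : c ^ g * c^-1 = q ^ g * q^-1.
    rewrite /q conjMg tpermJ gu gv invMg tpermV mulgA -[_ * _ * tperm u v]mulgA.
    by rewrite tperm2 mulg1.
  have qN : q \in 'N(U | 'P).
    apply/astabsP=> x; rewrite /= /aperm permM.
    have -> : (x \in U) = (c x \in c @: U) by rewrite mem_imset //; apply: perm_inj.
    rewrite cUE; case: tpermP => [->|->|/eqP/negPf-> /eqP/negPf-> //].
      by rewrite eqxx (negPf nUv).
    by have [uv|_] := eqVneq v u; [rewrite -uv (negPf nUv) in Uu' | rewrite eqxx].
  rewrite /inv_sign gq morphM ?groupJ ?groupV // morphJ // morphV //.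
  by rewrite odd_permM odd_permJ odd_permV addbb addn0.
by rewrite sumr_const card_astabs_fix2 // mulr_natr.
Qed.

End ArcsOfFullCycle.

(** * Quotients of full cycles *)

Section CountFullCycleQuotients.

Variables (T : finType) (c : {perm T}).
Hypothesis fc : full_cycle c.

Definition full_quotients : {set {perm T}} :=
  [set a | full_cycle a && full_cycle (a * c^-1)].

(** If no point of [U] lies outside [c @: U], then [U] is the whole set and its weight is 0; two
    such points give 0 by [signed_count_eq0]. The sum over [v] has at most one term and records the
    first point of an arc. *)
Lemma sum_signed_count (U : {set T}) : U != set0 ->
  (#|~: U|%:R * signed_count c U
    = \sum_(v | U :\: c @: U == [set v]) #|~: U|%:R * signed_count c U)%R.
Proof.
move=> U0; have [Uc|[v Uv]] := set_0Vmem (U :\: c @: U).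
  rewrite big_pred0 => [|v]; last first.
    by rewrite Uc eq_sym; apply/negP=> /eqP/setP/(_ v); rewrite !inE eqxx.
  suff -> : U = setT by rewrite setCT cards0 mul0r.
  have [x Ux] := set0Pn _ U0.
  have cU : U = c @: U.
    apply/eqP; rewrite eqEcard (card_imset U (@perm_inj _ c)) leqnn andbT.
    by rewrite -setD_eq0 Uc.
  apply/setP=> y; rewrite inE; have [i ->] := full_cycleX x y fc.
  elim: i => [|i IHi]; first by rewrite perm1.
  by rewrite expgSr permM cU mem_imset //; apply: perm_inj.
have [Uv1|] := eqVneq (U :\: c @: U) [set v].
  by rewrite (big_pred1 v) // => w; rewrite Uv1 (inj_eq set1_inj) eq_sym.
move=> Uv1; have [w Uw neq_vw] : exists2 w, w \in U :\: c @: U & v != w.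
  have /subsetPn[w Uw] : ~~ (U :\: c @: U \subset [set v]).
    by apply: contra Uv1 => sUv; rewrite eqEsubset sUv sub1set.
  by rewrite inE eq_sym => vw; exists w.
by rewrite (signed_count_eq0 neq_vw Uv Uw) mulr0 big1 // => *; rewrite mulr0.
Qed.

(** After multiplication by [#|T|], the weighted double sum over [a] and [U] is evaluated in both
    orders. Each of the [#|T|] possible first points of an arc contributes the same sum over [k]. *)
Lemma card_full_quotients_sum :
  (#|full_quotients|%:R = (#|T|.-1)`!%:R +
     \sum_(1 <= k < #|T|) (-1) ^+ k * (k.-1`! * (#|T| - k)`!)%:R :> int)%R.
Proof.
have [u _] := full_cycle_inhab fc.
have T_gt0 : 0 < #|T| by apply/card_gt0P; exists u.
apply: (mulfI (x := #|T|%:R)%R); first by rewrite pnatr_eq0 -lt0n.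
transitivity (\sum_(U : {set T}) #|~: U|%:R * signed_count c U)%R.
  rewrite -sum1_card natr_sum mulr_sumr.
  under [RHS]eq_bigr => U _ do rewrite /signed_count mulr_sumr.
  rewrite (exchange_big_dep (@full_cycle T)) /=; last by move=> U a _ /andP[].
  rewrite (eq_bigl _ _ (in_set _)) big_mkcondr.
  apply: eq_bigr => a fa; under [RHS]eq_bigl => U do rewrite fa.
  by rewrite sum_inv_sign_card; case: full_cycle; rewrite ?mulr1 ?mulr0.
rewrite (bigD1 set0) //= setC0 cardsT signed_count0 // mulrDr; congr (_ + _)%R.
rewrite (eq_bigr _ (fun U U0 => sum_signed_count U0)).
rewrite (exchange_big_dep predT) //=.
rewrite -[X in (X * _)%R]/(#|T|%:R)%R mulr_natl -sumr_const.
apply: eq_bigr => v _; rewrite -(sum_arcs fc _ v).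
apply: eq_big => [U|U /andP[_ /eqP Uv]].
  rewrite andb_idl // => /eqP Uv; apply: contraTneq (set11 v) => U0.
  by rewrite -Uv U0 set0D inE.
have Uv' : v \in U by have := set11 v; rewrite -Uv => /setDP[].
have [cU0|] := posnP #|~: U|.
  move: Uv'; have := Uv; rewrite -[U]setCK (cards0_eq cU0) setC0 => /setP/(_ v).
  by rewrite !inE eqxx mem_imset_perm inE.
(* The weight [#|~: U|] turns [(#|~: U| - 1)!] into [#|~: U|!], which is the factor
   [(#|T| - k)!]. *)
rewrite (signed_count_arc fc Uv) mulrCA; rewrite -(cardsC U) addKn; case: #|~: U| => // m _.
by rewrite -natrM mulnCA -factS.
Qed.

(** Telescopes by the identity [(m+2) k! (m-k)! = k! (m+1-k)! + (k+1)! (m-k)!]. *)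
Lemma alternating_fact_sum m p : p <= m ->
  ((m.+2)%:R * (\sum_(0 <= k < p) (-1) ^+ k * (k`! * (m - k)`!)%:R)
   = (m.+1)`!%:R - (-1) ^+ p * (p`! * (m.+1 - p)`!)%:R :> int)%R.
Proof.
elim: p => [|p IHp] le_pm; first by rewrite big_geq // mulr0 subn0 expr0 !mul1n mul1r subrr.
rewrite big_nat_recr //= mulrDr IHp ?(ltnW le_pm) // subSS subSn ?(ltnW le_pm) //.
rewrite !factS exprS !natrM -[(m - p).+1]addn1 natrD natrB ?(ltnW le_pm) //.
rewrite -!natr1; ring.
Qed.

Lemma card_full_quotients :
  odd #|T| -> ((#|T|.+1) * #|full_quotients| = 2 * (#|T|.-1)`!)%N.
Proof.
move=> oddT; apply/eqP; rewrite -(eqr_nat int) natrM card_full_quotients_sum.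
case: #|T| oddT => // m /= even_m; rewrite big_add1 /=.
under eq_bigr => k _ do rewrite exprS mulN1r mulNr subSS.
(* Here [#|T| = m + 1] is odd, so [m] is even and [(-1) ^+ m] in the boundary term is 1. *)
rewrite sumrN mulrBr alternating_fact_sum // -signr_odd (negPf even_m) subSnn.
rewrite muln1 mul1r factS !natrM -!natr1; apply/eqP; ring.
Qed.

End CountFullCycleQuotients.

(** * Extremal dessins *)

Section ExtremalDessins.

Variable d : nat.
Implicit Types (s : 'S_d) (t : triple d) (D : {set triple d}).

Lemma full_cycleV s : full_cycle s^-1 = full_cycle s.
Proof. by rewrite /full_cycle /porbits (eq_imset _ (porbitV s)). Qed.

Lemma full_cycle_exists : 0 < d -> exists s : 'S_d, full_cycle s.
Proof.
move=> d_gt0; pose s : 'S_d := perm (@ordS_inj d); exists s.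
apply: (@porbit_full_cycle _ _ (Ordinal d_gt0)); apply/setP=> y; rewrite inE.
apply/porbitP; exists y; apply/val_inj => /=.
suff sE i : i < d -> (s ^+ i) (Ordinal d_gt0) = i :> nat by rewrite sE.
elim: i => [|i IHi] lt_id; first by rewrite perm1.
by rewrite expgSr permM permE /= IHi ?modn_small // ltnW.
Qed.

Lemma cycle_type_full s : (cycle_type s == [:: d]) = full_cycle s.
Proof.
apply/eqP/idP=> [/(congr1 size)|fs].
  by rewrite size_sort size_image /full_cycle => ->.
have [x _] := full_cycle_inhab fs.
have -> : cycle_type s = sort geq [seq #|B| | B : {set 'I_d} in [set [set: 'I_d]]].
  congr (sort _ _); apply: eq_image => // B.
  apply/imsetP/set1P=> [[y _ ->]|->]; first exact: full_cycle_porbit.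
  by exists x; rewrite ?full_cycle_porbit.
by rewrite /image_mem enum_set1 /= cardsT card_ord.
Qed.

Definition extremal_triples : {set triple d} :=
  [set t | (sigma0 t * sigma1 t * sigmaoo t == 1)
           && [&& full_cycle (sigma0 t), full_cycle (sigma1 t) & full_cycle (sigmaoo t)]].

Lemma card_extremal_triples : odd d ->
  (d.+1 * #|extremal_triples| = 2 * d.-1`! * d.-1`!)%N.
Proof.
move=> odd_d; have [c0 fc0] := full_cycle_exists (odd_gt0 odd_d).
(* A pair [(c, a)] encodes the triple with [sigma1 = c] and [sigma0 * sigma1 = a], so that
   [sigma0 = a * c^-1] and [sigmaoo = a^-1]. *)
pose P := [set p : 'S_d * 'S_d | full_cycle p.1 && (p.2 \in full_quotients p.1)].
have -> : extremal_triples = [set (p.2 * p.1^-1, p.1, p.2^-1) | p in P].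
  apply/setP=> [[[a b] e]]; rewrite !inE /sigma0 /sigma1 /sigmaoo /=.
  apply/andP/imsetP=> [[/eqP abe /and3P[fa fb fe]]|[[c p]]].
    have e_ab : e = (a * b)^-1 by rewrite -[RHS]mulg1 -abe mulKg.
    exists (b, a * b) => /=; last by rewrite mulgK e_ab.
    by rewrite !inE /= fb mulgK fa -full_cycleV -e_ab fe.
  rewrite !inE /= => /and3P[fc fp fpc] [-> -> ->].
  by rewrite mulgKV mulgV fc fpc full_cycleV fp.
rewrite card_imset => [|[c p] [c' p'] [_ -> /invg_inj ->] //].
rewrite -sum1_card (eq_bigl _ _ (in_set _)).
rewrite -(pair_big_dep (@full_cycle 'I_d)
  (fun c a => a \in full_quotients c) (fun _ _ => 1%N)) /=.
rewrite big_distrr /= (eq_bigr (fun=> 2 * d.-1`!)%N) => [|c fc].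
  rewrite sum_nat_const mulnC; congr (_ * _)%N.
  rewrite -[in RHS](card_ord d) -(card_full_cycles fc0).
  by apply: eq_card => a; rewrite inE.
have := card_full_quotients fc; rewrite card_ord => <- //.
by rewrite -sum1_card.
Qed.

Lemma full_cycle_transitive t :
  full_cycle (sigma0 t) -> [transitive monodromy t, on [set: 'I_d] | 'P].
Proof.
move=> f0; have [x _] := full_cycle_inhab f0.
apply/imsetP; exists x => //; apply/esym/eqP.
rewrite -subTset -(full_cycle_porbit x f0) porbitE; apply: imsetS.
by rewrite cycle_subG mem_gen // set21.
Qed.

Lemma extremal_dessins_orbit D t : D \in extremal_dessins d -> t \in D ->
  D = orbit (conj_triple_action d) [set: 'S_d] t /\ t \in extremal_triples.
Proof.
rewrite inE => /andP[dD /eqP]; move=> pD tD; rewrite (passport_repr dD tD) in pD.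
case/imsetP: dD tD => t0; rewrite inE => /andP[/eqP t01 _] -> t0t.
split; first exact/esym/orbit_eqP.
case: pD => /eqP; rewrite cycle_type_full => f0 /eqP; rewrite cycle_type_full => f1.
move/eqP; rewrite cycle_type_full => foo; rewrite inE f0 f1 foo !andbT.
by case/orbitP: t0t => g _ <-; rewrite /sigma0 /sigma1 /sigmaoo /= -!conjMg t01 conj1g.
Qed.

Lemma orbit_extremal_triple t : t \in extremal_triples ->
  orbit (conj_triple_action d) [set: 'S_d] t \in extremal_dessins d.
Proof.
rewrite inE => /andP[t1 /and3P[f0 f1 foo]].
have dD : orbit (conj_triple_action d) [set: 'S_d] t \in dessins d.
  by apply: imset_f; rewrite inE t1 full_cycle_transitive.
rewrite inE dD (passport_repr dD (orbit_refl _ _ _)) /triple_passport.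
by rewrite !xpair_eqE !cycle_type_full f0 f1 foo.
Qed.

(** What commutes with [sigma0] and [sigma1] also commutes with [sigmaoo], the inverse of their
    product. The automorphism group is thus the stabilizer of [t] under simultaneous conjugation. *)
Lemma card_triple_aut t : sigma0 t * sigma1 t * sigmaoo t = 1 ->
  (#|orbit (conj_triple_action d) [set: 'S_d] t| * #|triple_aut t| = d`!)%N.
Proof.
move=> t1; rewrite -card_Sn -cardsT -(card_orbit_stab (conj_triple_action d) [set: 'S_d]%G t).
congr (_ * _)%N; apply: eq_card => g; rewrite setTI /= cent_gen centU !cent_set1 inE.
case: t t1 => [[a b] e]; rewrite /sigma0 /sigma1 /sigmaoo /= => abe.
have -> : e = (a * b)^-1 by rewrite -[RHS]mulg1 -abe mulKg.
apply/andP/astab1P => [[/cent1P ca /cent1P cb]|].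
  have fix_ x : commute g x -> x ^ g = x by move=> cgx; apply/conjg_fixP/commgP/commute_sym.
  by rewrite /= /conj_triple /= conjVg conjMg !fix_.
by case=> ca cb _; split; apply/cent1P/commute_sym/commgP/conjg_fixP.
Qed.

Lemma extremal_dessin_point D : D \in extremal_dessins d -> exists t, t \in D.
Proof.
by rewrite inE => /andP[/imsetP[t _ ->] _]; exists t; apply: orbit_refl.
Qed.

(** Automorphisms commute with the full cycle [sigma0], so they lie in the group of order [d] that
    it generates. *)
Lemma card_extremal_aut_dvd D : D \in extremal_dessins d -> #|dessin_aut D| %| d.
Proof.
move=> eD; have [t tD] := extremal_dessin_point eD.
have [_] := extremal_dessins_orbit eD tD; rewrite inE => /andP[_ /and3P[f0 _ _]].
rewrite (card_dessin_aut_repr _ tD); last by move: eD; rewrite inE => /andP[].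
rewrite -[X in _ %| X](card_ord d) -(full_cycle_order f0) cardSg //.
apply: subset_trans (full_cycle_cent f0); rewrite -cent_set1 centS //.
by rewrite sub1set mem_gen // set21.
Qed.

(** The extremal triples are partitioned into classes [D], and [#|D| / d!] is the inverse of the
    order of the automorphism group. *)
Lemma extremal_massE : extremal_mass d = (#|extremal_triples|%:R / d`!%:R)%R.
Proof.
rewrite -sum1_card natr_sum.
rewrite (partition_big (fun t => orbit (conj_triple_action d) [set: 'S_d] t)
           (mem (extremal_dessins d))) /=; last exact: orbit_extremal_triple.
rewrite mulr_suml; apply: eq_bigr => D eD.
have [t tD] := extremal_dessin_point eD; have [defD et] := extremal_dessins_orbit eD tD.
rewrite (eq_bigl (mem D)) => [|t']; last first.
  apply/andP/idP=> [[_ /eqP <-]|/(extremal_dessins_orbit eD)[-> ->] //].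
  exact: orbit_refl.
rewrite -natr_sum sum1_card (card_dessin_aut_repr _ tD); last first.
  by move: eD; rewrite inE => /andP[].
move: et; rewrite inE => /andP[/eqP/card_triple_aut <- _]; rewrite -defD natrM.
rewrite invfM mulrA mulfV ?mul1r // pnatr_eq0 -lt0n.
by apply/card_gt0P; exists t.
Qed.

End ExtremalDessins.

(** * The mass formula and the bounds on the number of classes *)

Local Open Scope ring_scope.

Theorem mainTheorem9 (d : nat) (hd3 : (3 <= d)%N) (hodd : odd d) :
  (forall D : {set triple d},
      D \in extremal_dessins d -> (#|dessin_aut D| %| d)%N)
  /\ [/\ (2 * (d - 1)`!)%N%:R / (d * (d + 1))%N%:R = extremal_mass d,
         extremal_mass d <= (extremal_count d)%:R,
         (extremal_count d)%:R <= d%:R * extremal_mass d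
       & d%:R * extremal_mass d = (2 * (d - 1)`!)%N%:R / (d + 1)%N%:R].
Proof.
have d_gt0 : (0 < d)%N by apply: leq_trans hd3.
have d_neq0 : d%:R != 0 :> rat by rewrite pnatr_eq0 -lt0n.
have d1_neq0 : (d + 1)%N%:R != 0 :> rat by rewrite pnatr_eq0 addn1.
have massE : (2 * (d - 1)`!)%N%:R / (d * (d + 1))%N%:R = extremal_mass d.
  have f_neq0 : (d - 1)`!%:R != 0 :> rat by rewrite pnatr_eq0 -lt0n fact_gt0.
  (* Dividing by [d!] cancels one of the two factors [(d - 1)!] in the number of extremal triples
     and leaves [d] in the denominator. *)
  have factE : d`! = (d * (d - 1)`!)%N by rewrite subn1 -{1}(prednK d_gt0) factS prednK.
  have /(congr1 (fun n => n%:R : rat)) := card_extremal_triples hodd.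
  rewrite extremal_massE factE -subn1 -addn1 !natrM.
  move/(canRL (mulKf d1_neq0)) => ->; field.
  by rewrite f_neq0 d_neq0 natr1 -addn1 d1_neq0.
split; first exact: card_extremal_aut_dvd.
split=> //.
- rewrite /extremal_count -sum1_card natr_sum; apply: ler_sum => D _.
  by rewrite invf_le1 ?ltr0n ?cardG_gt0 // ler1n cardG_gt0.
(* Each automorphism group has order at most [d], so every term of the mass is at least [1 / d]. *)
- rewrite /extremal_count -sum1_card natr_sum /extremal_mass mulr_sumr.
  apply: ler_sum => D /card_extremal_aut_dvd/(dvdn_leq d_gt0) le_d.
  by rewrite ler_pdivlMr ?ltr0n ?cardG_gt0 // mul1r ler_nat.
- by rewrite -massE [(d * (d + 1))%:R]natrM invfM mulrCA mulVKf.
Qed.
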